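(* Let $f:\{0,1\}^n\to\{0,1\}$ be a Boolean function whose upward closure $f^{\uparrow}$ is non-constant. Then \[ \mathrm{Arith}\big(\mathrm{Env}(\mathrm{Low}(f))\big)\leq \mathrm{Read}_1(f^{\uparrow})\leq \mathrm{mLin}(f^{\uparrow})\leq \mathrm{Lin}(f). \]
   Context: The upward closure of a Boolean function $f$ is the monotone function $f^{\uparrow}(x)=\bigvee_{z\leq x}f(z)$. For any Boolean $f$, $\mathrm{Low}(f)$ is the set of $a\in\{0,1\}^n$ with $f(a)=1$ and $f(b)=0$ for all $b\leq a$, $b\neq a$. A monotone Boolean circuit is a directed acyclic graph (parallel edges allowed) whose indegree-zero nodes hold variables among $x_1,\dots,x_n$ (no constants) and whose gates have indegree two and are labeled $\lor$ or $\land$; size = number of gates. The set $B_F\subseteq\mathbb{N}^n$ of exponent vectors produced by $F$: $B_{x_i}=\{e_i\}$, $B_{G\lor H}=B_G\cup B_H$, $B_{G\land H}=\{b+c:b\in B_G,c\in B_H\}$. $\mathrm{supp}(a)=\{i:a_i\neq 0\}$. A monotone circuit computing a monotone $g$ is read-$1$ if $\mathrm{Low}(g)\subseteq B_F$ (equivalently every $a\in\mathrm{Low}(g)$ has $b\in B_F$ with $\mathrm{supp}(b)=\mathrm{supp}(a)$ and all $b_i\leq1$); $\mathrm{Read}_1(g)$ is the minimum size of such a circuit. A DeMorgan circuit is a $(\lor,\land)$ circuit whose inputs are the literals $x_1,\dots,x_n,\bar x_1,\dots,\bar x_n$. A Boolean function depends on $x_i$ if its value changes for some pair of inputs differing only in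 position $i$; two functions are independent if they depend on disjoint sets of variables. A (DeMorgan or monotone) circuit is multilinear if the two functions computed at the inputs of every AND gate are independent. $\mathrm{Lin}(f)$ is the minimum size of a multilinear DeMorgan circuit computing $f$; for monotone $g$, $\mathrm{mLin}(g)$ is the minimum size of a monotone multilinear circuit computing $g$. For finite $A\subseteq\mathbb{N}^n$, $\mathrm{Arith}(A)$ is the minimum size of a monotone arithmetic $(+,\times)$ circuit with only variables as inputs producing (as formal expansion, no cancellations) a polynomial $\sum_{a\in A}c_a\prod_ix_i^{a_i}$ with integers $c_a\geq1$. $\mathrm{Env}(A)$ is the set of vectors $a\in A$ of minimum degree $a_1+\dots+a_n$. *)

(* Defs.v *)
From mathcomp Require Export all_boot all_order all_algebra.
From mathcomp Require Export finmap.
From mathcomp.multinomials Require Export mpoly.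

Set Implicit Arguments.
Unset Strict Implicit.
Unset Printing Implicit Defensive.

Import GRing.Theory.

Definition point (n : nat) := {ffun 'I_n -> bool}.

Definition boolfun (n : nat) := point n -> bool.

Definition point_le n (x y : point n) : bool := [forall i, x i ==> y i].

Definition nonconstant n (f : boolfun n) : Prop :=
  ~ exists b : bool, forall x, f x = b.

Definition upclosure n (f : boolfun n) : boolfun n :=
  fun x => [exists z : point n, point_le z x && f z].

Definition depends n (f : boolfun n) (i : 'I_n) : Prop :=
  exists x y : point n, (forall j, j != i -> x j = y j) /\ f x <> f y.

Definition independent n (f g : boolfun n) : Prop :=
  forall i, ~ (depends f i /\ depends g i).

(* Elements of N^n are represented by the monomials 'X_{1..n}. *)

Definition expvec n (a : point n) : 'X_{1..n} := [multinom (a i : nat) | i < n].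

Definition lowpoints n (f : boolfun n) : {set point n} :=
  [set a | f a & [forall b : point n, point_le b a && (b != a) ==> ~~ f b]].

Definition Low n (f : boolfun n) : {fset 'X_{1..n}} :=
  [fset expvec a | a in lowpoints f]%fset.

Definition Env n (A : {fset 'X_{1..n}}) : {fset 'X_{1..n}} :=
  [fset a in A | [forall b : A, mdeg a <= mdeg (val b)]]%fset.

(* In arithmetic circuits Vee stands for + and Wedge for *. *)
Inductive connective := Vee | Wedge.

Inductive node (X : Type) := Input of X | Gate of nat.
Arguments Gate {X} _.

Record gate (X : Type) := MkGate { op : connective; lhs : node X; rhs : node X }.

Definition below X (k : nat) (u : node X) : bool :=
  if u is Gate j then j < k else true.

(* A DAG with input labels in X: its gates are listed in a topological order,
   Gate j being the gate at position j of the list (counting from 0).  Any node,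
   including an input, may be the output. *)
Record circuit (X : Type) := Circuit {
  gates : seq (gate X);
  output : node X;
  gates_below : forall k g,
    onth gates k = Some g -> below k (lhs g) && below k (rhs g);
  output_below : below (size gates) output
}.

Definition circuit_size X (c : circuit X) : nat := size (gates c).

Section Evaluation.

(* The default t0 is never used, by gates_below and output_below. *)
Variables (X T : Type) (t0 : T) (inp : X -> T) (vee wedge : T -> T -> T).

Definition node_value (vs : seq T) (u : node X) : T :=
  match u with Input s => inp s | Gate j => nth t0 vs j end.

Definition gate_value (vs : seq T) (g : gate X) : T :=
  (if op g is Vee then vee else wedge)
    (node_value vs (lhs g)) (node_value vs (rhs g)).

Definition gate_values (gs : seq (gate X)) : seq T :=
  foldl (fun vs g => rcons vs (gate_value vs g)) [::] gs.

Definition value_at (c : circuit X) (u : node X) : T :=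
  node_value (gate_values (gates c)) u.

End Evaluation.

(* The minimum is attained and equal to m; false if no circuit satisfies P. *)
Definition minimum_size X (P : circuit X -> Prop) (m : nat) : Prop :=
  (exists c, P c /\ circuit_size c = m) /\ (forall c, P c -> m <= circuit_size c).

Section BooleanCircuits.

Variables (n : nat) (X : Type) (interp : X -> boolfun n).

Definition fun_at (c : circuit X) (u : node X) : boolfun n :=
  fun x => value_at false (fun s => interp s x) orb andb c u.

Definition computes (c : circuit X) (f : boolfun n) : Prop :=
  forall x, fun_at c (output c) x = f x.

Definition multilinear (c : circuit X) : Prop :=
  forall k g, onth (gates c) k = Some g -> op g = Wedge ->
    independent (fun_at c (lhs g)) (fun_at c (rhs g)).

End BooleanCircuits.

Definition monotone_circuit (n : nat) := circuit 'I_n.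

Definition variable n (i : 'I_n) : boolfun n := fun x => x i.

Inductive literal (n : nat) := Pos of 'I_n | Neg of 'I_n.

Definition demorgan_circuit (n : nat) := circuit (literal n).

Definition literal_fun n (l : literal n) : boolfun n :=
  fun x => match l with Pos i => x i | Neg i => ~~ x i end.

Definition minkowski n (A B : {fset 'X_{1..n}}) : {fset 'X_{1..n}} :=
  [fset (b + c)%MM | b in A, c in B]%fset.

Definition produced n (c : monotone_circuit n) : {fset 'X_{1..n}} :=
  value_at fset0 (fun i : 'I_n => [fset U_(i)%MM]%fset)
    (@fsetU 'X_{1..n}) (@minkowski n) c (output c).

(* Used only for monotone g. *)
Definition read1 n (g : boolfun n) (c : monotone_circuit n) : Prop :=
  computes (@variable n) c g /\ (Low g `<=` produced c)%fset.

Definition arith_circuit (n : nat) := circuit 'I_n.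

(* The inputs are variables only and the gates + and *, so all coefficients are
   nonnegative and no cancellation can occur in this ring: the value is the
   formal expansion. *)
Definition poly_of n (c : arith_circuit n) : {mpoly int[n]} :=
  value_at 0%R (fun i : 'I_n => 'X_i)%R +%R *%R c (output c).

Definition produces_support n (A : {fset 'X_{1..n}}) (c : arith_circuit n) : Prop :=
  exists coef : 'X_{1..n} -> int,
    (forall a, a \in A -> (1 <= coef a)%R) /\
    poly_of c = (\sum_(a <- A) coef a *: 'X_[a])%R.

Definition Arith_is n (A : {fset 'X_{1..n}}) (m : nat) : Prop :=
  minimum_size (@produces_support n A) m.

Definition Read1_is n (g : boolfun n) (m : nat) : Prop :=
  minimum_size (read1 g) m.

Definition mLin_is n (g : boolfun n) (m : nat) : Prop :=
  minimum_size (fun c : monotone_circuit n =>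
    computes (@variable n) c g /\ multilinear (@variable n) c) m.

Definition Lin_is n (f : boolfun n) (m : nat) : Prop :=
  minimum_size (fun c : demorgan_circuit n =>
    computes (@literal_fun n) c f /\ multilinear (@literal_fun n) c) m.

(* Main.v *)
(* If g and h are independent, the upward closure of g /\ h is the conjunction of
   the closures, so taking closures gate by gate turns a multilinear DeMorgan
   circuit for f into a monotone multilinear one for the closure of f.  In a
   monotone multilinear circuit the lowest points of a conjunction g /\ h are sums
   of lowest points of g and of h with disjoint supports, so the circuit is
   read-1.  Finally, every vector produced by a read-1 circuit lies above some
   lowest point, so its produced vectors of minimum degree are exactly the lowest
   points of minimum degree; keeping only minimum-degree parts at every gate then
   yields an arithmetic circuit. *)
From Stdlib Require Import Classical_Prop.
Require Import Defs.

Set Implicit Arguments.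
Unset Strict Implicit.
Unset Printing Implicit Defensive.

Import GRing.Theory Num.Theory.

(** * Circuits *)

Lemma below_leq X i j (u : node X) : i <= j -> below i u -> below j u.
Proof. by case: u => //= k ij /leq_trans; apply. Qed.

Lemma onth_size T (s : seq T) k x : onth s k = Some x -> k < size s.
Proof. by move=> E; rewrite -onthTE E. Qed.

Lemma onth_rcons T (s : seq T) x k :
  onth (rcons s x) k =
  if k < size s then onth s k else if k == size s then Some x else None.
Proof.
rewrite -cats1 onth_cat; case: ltngtP => [//|lt|->]; last by rewrite subnn.
by rewrite onth_default //= subn_gt0.
Qed.

Lemma onth_rconsP T (s : seq T) x k y : onth (rcons s x) k = Some y ->
  (k < size s /\ onth s k = Some y) \/ (k = size s /\ y = x).
Proof.
rewrite onth_rcons; case: ltngtP => // [lt|->]; first by left.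
by case=> ->; right.
Qed.

Lemma onth_take_drop T (s : seq T) k x :
  onth s k = Some x -> s = rcons (take k s) x ++ drop k.+1 s.
Proof.
move=> E; have lt := onth_size E.
by rewrite -(@onth_nth _ x _ _ _ E) -take_nth // cat_take_drop.
Qed.

Lemma lhs_below X (c : circuit X) k g :
  onth (gates c) k = Some g -> below (size (gates c)) (lhs g).
Proof.
move=> E; have /andP[H _] := gates_below E.
exact: below_leq (ltnW (onth_size E)) H.
Qed.

Lemma rhs_below X (c : circuit X) k g :
  onth (gates c) k = Some g -> below (size (gates c)) (rhs g).
Proof.
move=> E; have /andP[_ H] := gates_below E.
exact: below_leq (ltnW (onth_size E)) H.
Qed.

(** Strong induction on the gate index: the operands of gate [k] are inputs or gates of index below
    [k]. *)
Lemma node_ind X (c : circuit X) (P : node X -> Prop) :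
  (forall s, P (Input s)) ->
  (forall k g, onth (gates c) k = Some g ->
     P (lhs g) -> P (rhs g) -> P (Gate k)) ->
  forall u, below (size (gates c)) u -> P u.
Proof.
move=> Pin Pgate [s //|k] /=; elim/ltn_ind: k => k IH lt.
have IHu u : below k u -> P u.
  by case: u => //= j jk; apply: IH => //; apply: ltn_trans lt.
case E: (onth (gates c) k) => [g|]; last by rewrite -onthTE E in lt.
by have /andP[? ?] := gates_below E; apply: Pgate E _ _; apply: IHu.
Qed.

Section Values.
Variables (X T : Type) (t0 : T) (inp : X -> T) (vee wedge : T -> T -> T).

Local Notation gate_values := (gate_values t0 inp vee wedge).
Local Notation gate_value := (gate_value t0 inp vee wedge).
Local Notation node_value := (node_value t0 inp).
Local Notation value_at := (value_at t0 inp vee wedge).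

Lemma gate_values_rcons gs g :
  gate_values (rcons gs g) = rcons (gate_values gs) (gate_value (gate_values gs) g).
Proof. exact: foldl_rcons. Qed.

Lemma size_gate_values gs : size (gate_values gs) = size gs.
Proof.
by elim/last_ind: gs => // gs g IH; rewrite gate_values_rcons !size_rcons IH.
Qed.

Lemma node_value_cat gs e u : below (size gs) u ->
  node_value (gate_values (gs ++ e)) u = node_value (gate_values gs) u.
Proof.
move=> lt; elim/last_ind: e => [|e g IH]; first by rewrite cats0.
rewrite -rcons_cat gate_values_rcons -IH; case: u lt {IH} => //= k lt.
by rewrite nth_rcons size_gate_values size_cat ltn_addr.
Qed.

(** The fold evaluates gate [k] from the first [k] values alone; its operands lie below [k], so
    later gates leave these values unchanged. With [node_ind] this reduces reasoning about circuits
    to local recursion. *)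
Lemma value_at_gate (c : circuit X) k g : onth (gates c) k = Some g ->
  value_at c (Gate k) =
  (if op g is Vee then vee else wedge) (value_at c (lhs g)) (value_at c (rhs g)).
Proof.
move=> E; have lt := onth_size E; have /andP[Hl Hr] := gates_below E.
have sz : size (take k (gates c)) = k by rewrite size_take lt.
rewrite /value_at (onth_take_drop E) node_value_cat /= ?size_rcons ?sz //.
rewrite gate_values_rcons nth_rcons size_gate_values sz ltnn eqxx.
by rewrite cat_rcons !node_value_cat ?sz.
Qed.

End Values.

(* The action [Some b] deletes a gate, redirecting its fan-out to the left
   (b = true) or right (b = false) operand. *)
Lemma prune X Y (inp : X -> Y) (act : gate X -> option bool) (c : circuit X) :
  exists (c' : circuit Y) (phi : node X -> node Y),
  [/\ circuit_size c' <= circuit_size c,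
      output c' = phi (output c),
      forall s, phi (Input s) = Input (inp s),
      forall k g, onth (gates c) k = Some g ->
        if act g is Some b then phi (Gate k) = phi (if b then lhs g else rhs g)
        else exists2 j, phi (Gate k) = Gate j &
          onth (gates c') j = Some (MkGate (op g) (phi (lhs g)) (phi (rhs g)))
    & forall j g', onth (gates c') j = Some g' ->
        exists k g, [/\ onth (gates c) k = Some g, act g = None &
          g' = MkGate (op g) (phi (lhs g)) (phi (rhs g))]].
Proof.
case: c => gs o wf; rewrite /circuit_size /= => ob.
suff [gs' [phi [wf' sz phi_in phi_below [keep new]]]] :
  exists (gs' : seq (gate Y)) (phi : node X -> node Y),
  [/\ forall k g, onth gs' k = Some g -> below k (lhs g) && below k (rhs g),
      size gs' <= size gs,
      forall s, phi (Input s) = Input (inp s),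
      forall u, below (size gs) u -> below (size gs') (phi u) &
      (forall k g, onth gs k = Some g ->
        if act g is Some b then phi (Gate k) = phi (if b then lhs g else rhs g)
        else exists2 j, phi (Gate k) = Gate j &
          onth gs' j = Some (MkGate (op g) (phi (lhs g)) (phi (rhs g)))) /\
      (forall j g', onth gs' j = Some g' ->
        exists k g, [/\ onth gs k = Some g, act g = None &
          g' = MkGate (op g) (phi (lhs g)) (phi (rhs g))])].
  by exists (Circuit wf' (phi_below _ ob)), phi.
elim/last_ind: gs wf {o ob} => [|gs g IH] wf.
  (* Without gates, the image of a [Gate] node is never consulted; [Gate 0] is a placeholder. *)
  exists [::], (fun u => if u is Input s then Input (inp s) else Gate 0).
  by split=> //; [move=> k g; rewrite onth0n|case|split=> k g; rewrite onth0n].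
have [k h E|gs' [phi [wf' sz phi_in phi_below [keep new]]]] := IH.
  by apply: wf; rewrite onth_rcons (onth_size E).
have /andP[gl gr] : below (size gs) (lhs g) && below (size gs) (rhs g).
  by apply: wf; rewrite onth_rcons ltnn eqxx.
(* Only the index of the last gate gets a new image [v]: the image of an operand if the gate is
   deleted, the end of [gs'] if it is kept. Operands of earlier gates keep their images. *)
pose phi' v u := if u is Gate k then if k == size gs then v else phi u else phi u.
have phi'E v u : below (size gs) u -> phi' v u = phi u.
  by case: u => //= k; case: ltngtP.
have phi'g v k h : onth gs k = Some h ->
    [/\ phi' v (Gate k) = phi (Gate k), phi' v (lhs h) = phi (lhs h)
      & phi' v (rhs h) = phi (rhs h)].
  move=> E; have lt := onth_size E.
  have /andP[hl hr] : below k (lhs h) && below k (rhs h).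
    by apply: wf; rewrite onth_rcons lt.
  by rewrite !phi'E //; apply: below_leq (ltnW lt) _.
have phi'_below v m : size gs' <= m -> below m v ->
    forall u, below (size (rcons gs g)) u -> below m (phi' v u).
  move=> le bv [s|k] /=; first by rewrite phi_in.
  rewrite size_rcons ltnS leq_eqVlt; case: eqP => //= _ lt.
  exact: below_leq le (phi_below (Gate k) lt).
case A: (act g) => [b|].
  pose v := phi (if b then lhs g else rhs g).
  exists gs', (phi' v); split=> //; first by rewrite size_rcons ltnW.
    by apply: phi'_below => //; apply: phi_below; case: b {A v}.
  split=> [k h Ek|j g' Ej].
    have [[lt E]|[-> ->]] := onth_rconsP Ek; last first.
      by rewrite A [LHS]/= eqxx phi'E //; case: b {A v}.
    have := keep _ _ E; have [-> el er] := phi'g v _ _ E.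
    by case: (act h) => [[]|]; rewrite ?el ?er.
  have [k [h [E Ah ->]]] := new _ _ Ej.
  exists k, h; have [_ -> ->] := phi'g v _ _ E.
  by rewrite onth_rcons (onth_size E).
pose v : node Y := Gate (size gs').
exists (rcons gs' (MkGate (op g) (phi (lhs g)) (phi (rhs g)))), (phi' v); split=> //.
- by move=> k h Ek; have [[_ /wf']|[-> ->]] := onth_rconsP Ek; rewrite //= !phi_below.
- by rewrite !size_rcons.
- by apply: phi'_below => /=; rewrite size_rcons.
split=> [k h Ek|j g' Ej].
  have [[lt E]|[-> ->]] := onth_rconsP Ek; last first.
    rewrite A; exists (size gs'); first by rewrite /= eqxx.
    by rewrite onth_rcons ltnn eqxx !phi'E.
  have := keep _ _ E; have [-> el er] := phi'g v _ _ E.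
  case: (act h) => [[]|[j -> Ej]]; rewrite ?el ?er //; exists j => //.
  by rewrite onth_rcons (onth_size Ej).
have [[_ Ej']|[_ ->]] := onth_rconsP Ej; last first.
  by exists (size gs), g; rewrite onth_rcons ltnn eqxx !phi'E.
have [k [h [E Ah ->]]] := new _ _ Ej'.
exists k, h; have [_ -> ->] := phi'g v _ _ E.
by rewrite onth_rcons (onth_size E).
Qed.
(** * Boolean functions *)

Section BooleanFunctions.
Variable n : nat.
Implicit Types (f g h : boolfun n) (x y z a b : point n).

Definition minpoint f a := f a /\ forall b, point_le b a -> f b -> b = a.

Definition monotone_fun f := forall x y, point_le x y -> f x -> f y.

Lemma point_leP x y : reflect (forall i, x i -> y i) (point_le x y).
Proof. by apply: (iffP forallP) => H i; apply/implyP/H. Qed.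

Lemma point_le_refl x : point_le x x.
Proof. exact/point_leP. Qed.

Lemma point_le_trans y x z : point_le x y -> point_le y z -> point_le x z.
Proof. by move=> /point_leP xy /point_leP yz; apply/point_leP => i /xy /yz. Qed.

Lemma expvec_le x y : point_le x y = (expvec x <= expvec y)%MM.
Proof.
apply/point_leP/mnm_lepP => H i; have := H i; rewrite !mnmE.
  by case: (x i) => // ->.
by case: (x i) (y i) => [] [].
Qed.

Lemma expvec_inj : injective (@expvec n).
Proof.
move=> x y /mnmP E; apply/ffunP => i; have := E i; rewrite !mnmE.
by case: (x i) (y i) => [] [].
Qed.

Lemma mnm_le_deg_eq (b c : 'X_{1..n}) : (b <= c)%MM -> mdeg c <= mdeg b -> b = c.
Proof.
move=> /submK <-; rewrite mdegD -{2}[mdeg b]add0n leq_add2r leqn0 mdeg_eq0.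
by move=> /eqP ->; rewrite add0m.
Qed.

Lemma mnm_le_mdeg (b c : 'X_{1..n}) : (b <= c)%MM -> mdeg b <= mdeg c.
Proof. by move=> /submK <-; rewrite mdegD leq_addl. Qed.

(** A true point below [x] with the fewest ones is minimal. *)
Lemma minpoint_exists f x : f x -> exists2 a, point_le a x & minpoint f a.
Proof.
move=> fx; pose P := [pred b | point_le b x && f b].
have Px : P x by rewrite /= point_le_refl.
case: (arg_minnP (fun b => mdeg (expvec b)) Px) => a /andP[ax fa] amin.
exists a => //; split=> // b ba fb; apply: expvec_inj.
apply: mnm_le_deg_eq; first by rewrite -expvec_le.
by apply: amin; rewrite /= fb (point_le_trans ba ax).
Qed.

Lemma minpointP f a : reflect (minpoint f a) (a \in lowpoints f).
Proof.
rewrite inE; apply: (iffP andP) => -[fa H]; split=> //.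
  move=> b ba fb; apply/eqP/negPn/negP => nba.
  by have /forallP/(_ b) := H; rewrite ba nba fb.
apply/forallP => b; apply/implyP => /andP[ba nba]; apply/negP => fb.
by rewrite (H b ba fb) eqxx in nba.
Qed.

Lemma LowP f m : reflect (exists2 a, minpoint f a & m = expvec a) (m \in Low f).
Proof.
apply: (iffP idP) => [/imfsetP[a /= /minpointP Ha ->]|[a /minpointP Ha ->]].
  by exists a.
by apply/imfsetP; exists a.
Qed.

Lemma upclosureP f x :
  reflect (exists2 z, point_le z x & f z) (upclosure f x).
Proof.
by apply: (iffP existsP) => [[z /andP[]]|[z zx fz]]; exists z => //; apply/andP.
Qed.

(** A true point of the closure dominates a true point of [f], which is also true for the closure;
    minimality makes the two coincide. *)
Lemma minpoint_upclosure f a : minpoint (upclosure f) a <-> minpoint f a.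
Proof.
split=> -[Ha amin]; split.
- have /upclosureP[z za fz] := Ha.
  by rewrite -(amin z za) //; apply/upclosureP; exists z; rewrite ?point_le_refl.
- move=> b ba fb; apply: amin => //; apply/upclosureP.
  by exists b; rewrite ?point_le_refl.
- by apply/upclosureP; exists a; rewrite ?point_le_refl.
- move=> b ba /upclosureP[z zb fz].
  have za := amin z (point_le_trans zb ba) fz; rewrite {}za in zb.
  apply/ffunP => i; apply/idP/idP.
    by move/point_leP: ba; apply.
  by move/point_leP: zb; apply.
Qed.

Lemma Low_upclosure f : Low (upclosure f) = Low f.
Proof.
apply/fsetP => m.
by apply/LowP/LowP => -[a /minpoint_upclosure Ha ->]; exists a.
Qed.

(** Clearing coordinate [i] of [a] gives a strictly smaller point, where [f] must vanish. *)
Lemma minpoint_depends f a i : minpoint f a -> a i -> depends f i.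
Proof.
move=> [fa amin] ai; pose b : point n := [ffun j => (j != i) && a j].
exists a, b; split=> [j nji|fab]; first by rewrite ffunE nji.
have ba : point_le b a by apply/point_leP => j; rewrite ffunE => /andP[].
by move: ai; rewrite -(amin b ba) ?ffunE ?eqxx // -fab.
Qed.

(** Decidability of dependence allows a point to be defined by cases on it, as in
    [upclosure_and]. *)
Lemma dependsP f i :
  reflect (depends f i)
    [exists x : point n, exists y : point n, [forall j, (j != i) ==> (x j == y j)]
      && (f x != f y)].
Proof.
apply: (iffP existsP) => [[x /existsP[y /andP[/forallP E /eqP N]]]|[x [y [E N]]]].
  by exists x, y; split=> // j nji; have := E j; rewrite nji => /eqP.
exists x; apply/existsP; exists y; apply/andP; split; last exact/eqP.
by apply/forallP => j; apply/implyP => /E ->.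
Qed.

Lemma eq_on_depends f x y :
  (forall i, depends f i -> x i = y i) -> f x = f y.
Proof.
(* Hybrids pass from [y] to [x] one coordinate at a time; a step that changed [f] would occur at a
   variable of [f], where [x] and [y] agree. *)
move=> E; pose hyb (s : seq 'I_n) : point n := [ffun i => if i \in s then x i else y i].
have H (s : seq 'I_n) : f (hyb s) = f y.
  elim: s => [|i s <-]; first by congr f; apply/ffunP => i; rewrite ffunE.
  apply/eqP/negPn/negP => /eqP N.
  have D : depends f i.
    by exists (hyb (i :: s)), (hyb s); split=> // j nji; rewrite !ffunE inE (negPf nji).
  apply: N; congr f; apply/ffunP => j; rewrite !ffunE inE.
  by case: eqP => //= ->; rewrite E // if_same.
by rewrite -(H (enum 'I_n)); congr f; apply/ffunP => i; rewrite ffunE mem_enum.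
Qed.

Lemma upclosure_or f g h : (forall x, h x = f x || g x) ->
  forall x, upclosure h x = upclosure f x || upclosure g x.
Proof.
move=> E x; apply/upclosureP/orP => [[z zx]|].
  by rewrite E => /orP[?|?]; [left|right]; apply/upclosureP; exists z.
by case=> /upclosureP[z zx Hz]; exists z => //; rewrite E Hz ?orbT.
Qed.

(** Witnesses [y] for [f] and [z] for [g] are glued: [y] on the variables of [f], [z] elsewhere. By
    independence the latter include all variables of [g], so both functions hold at the glued
    point. *)
Lemma upclosure_and f g h : independent f g -> (forall x, h x = f x && g x) ->
  forall x, upclosure h x = upclosure f x && upclosure g x.
Proof.
move=> I E x; apply/upclosureP/andP => [[z zx]|].
  by rewrite E => /andP[? ?]; split; apply/upclosureP; exists z.
case=> /upclosureP[y yx fy] /upclosureP[z zx gz].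
pose w : point n := [ffun i => if dependsP f i is ReflectT _ then y i else z i].
exists w.
  apply/point_leP => i; rewrite ffunE; case: dependsP => _.
    by move/point_leP: yx; apply.
  by move/point_leP: zx; apply.
rewrite E; apply/andP; split.
  by rewrite (@eq_on_depends _ w y) // => i D; rewrite ffunE; case: dependsP.
rewrite (@eq_on_depends _ w z) // => i D; rewrite ffunE.
by case: dependsP => // D'; case: (I i).
Qed.

(** If the closure holds at [x] but not at [y], a witness [z] below [x] and its meet with [y] differ
    only at [i], and [f] separates them. *)
Lemma depends_upclosure f i : depends (upclosure f) i -> depends f i.
Proof.
have aux x y : (forall j, j != i -> x j = y j) ->
    upclosure f x -> ~~ upclosure f y -> depends f i.
  move=> E /upclosureP[z zx fz] Ny.
  pose w : point n := [ffun j => z j && y j].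
  have /negPf fw : ~~ f w.
    apply: contra Ny => fw; apply/upclosureP; exists w => //.
    by apply/point_leP => j; rewrite ffunE => /andP[].
  exists z, w; split; last by rewrite fz fw.
  move=> j /E xy; rewrite ffunE; case zj: (z j) => //=.
  by rewrite -xy; move/point_leP: zx => ->.
case=> x [y [E N]]; case fx: (upclosure f x); case fy: (upclosure f y).
- by rewrite fx fy in N.
- by apply: (aux x y); rewrite ?fx ?fy.
- by apply: (aux y x); rewrite ?fx ?fy // => j /E.
- by rewrite fx fy in N.
Qed.

Lemma independent_upclosure f g :
  independent f g -> independent (upclosure f) (upclosure g).
Proof. by move=> I i [/depends_upclosure ? /depends_upclosure ?]; apply: (I i). Qed.

Lemma eq_depends f g i : f =1 g -> depends f i -> depends g i.
Proof. by move=> E [x [y [H N]]]; exists x, y; rewrite -!E. Qed.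

Lemma eq_independent f f' g g' : f =1 f' -> g =1 g' ->
  independent f g -> independent f' g'.
Proof.
move=> Ef Eg I i [Df Dg].
by case: (I i); split; [apply: eq_depends Df|apply: eq_depends Dg].
Qed.

End BooleanFunctions.

Lemma fun_at_gate n X (interp : X -> boolfun n) (c : circuit X) k g x :
  onth (gates c) k = Some g ->
  fun_at interp c (Gate k) x =
  (if op g is Vee then orb else andb)
    (fun_at interp c (lhs g) x) (fun_at interp c (rhs g) x).
Proof. exact: value_at_gate. Qed.

(** * From multilinear DeMorgan circuits to monotone ones *)

(* Nodes whose upward closure is the constant 1, such as the negated variables,
   are eliminated. *)
Lemma multilinear_upclosure n (f : boolfun n) (c : demorgan_circuit n) :
  nonconstant (upclosure f) ->
  computes (@literal_fun n) c f -> multilinear (@literal_fun n) c ->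
  exists c' : monotone_circuit n,
    [/\ computes (@variable n) c' (upclosure f), multilinear (@variable n) c'
      & circuit_size c' <= circuit_size c].
Proof.
move=> nc cf ml.
pose F := fun_at (@literal_fun n) c.
pose one u := [forall x, upclosure (F u) x].
(* An OR gate with a constant operand has constant closure itself, so its redirection is immaterial;
   an AND gate with a constant operand passes on the other one. *)
pose act (g : gate (literal n)) := match op g with
  | Vee => if one (lhs g) || one (rhs g) then Some true else None
  | Wedge => if one (lhs g) then Some false
             else if one (rhs g) then Some true else None end.
(* The image of [Neg i] is arbitrary: its closure is constantly 1, already witnessed by the zero
   point, and [inv] excludes such nodes. *)
pose inp (l : literal n) := match l with Pos i => i | Neg i => i end.
have [c' [phi [sz out phi_in keep new]]] := prune inp act c.
have inv u : below (size (gates c)) u -> ~~ one u ->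
    fun_at (@variable n) c' (phi u) =1 upclosure (F u).
  elim/(@node_ind _ c): u / => [s|k g E IHl IHr].
    rewrite phi_in => H x; rewrite /fun_at /value_at /=.
    case: s H => i /forallPn[y Hy] /=.
      apply/idP/upclosureP => [xi|[z /point_leP zx /zx //]].
      by exists x; rewrite ?point_le_refl.
    case/negP: Hy; apply/upclosureP; exists [ffun=> false].
      by apply/point_leP => j; rewrite ffunE.
    by rewrite /F /fun_at /value_at /= ffunE.
  have FE := fun_at_gate (@literal_fun n) _ E.
  have := keep _ _ E; rewrite /act => K.
  case Eop: (op g) K FE => K FE.
    have up := upclosure_or FE.
    have le1 : one (lhs g) -> one (Gate k).
      by move=> /forallP H; apply/forallP => x; rewrite up H.
    have le2 : one (rhs g) -> one (Gate k).
      by move=> /forallP H; apply/forallP => x; rewrite up H orbT.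
    move=> N; have Nl := contra le1 N; have Nr := contra le2 N.
    move: K; rewrite (negPf Nl) (negPf Nr) => -[j -> Ej] x.
    by rewrite (fun_at_gate _ _ Ej) /= IHl // IHr // up.
  have I : independent (F (lhs g)) (F (rhs g)) by apply: ml E Eop.
  have up := upclosure_and I FE.
  move=> N x; rewrite up; move: K.
  case: ifPn => [l1|Nl].
    have Nr : ~~ one (rhs g).
      apply: contra N => /forallP r1; apply/forallP => y.
      by rewrite up r1; move/forallP: l1 => ->.
    by move=> ->; rewrite IHr //; move/forallP: l1 => ->.
  case: ifPn => [r1|Nr].
    by move=> ->; rewrite IHl //; move/forallP: r1 => ->; rewrite andbT.
  by case=> j -> Ej; rewrite (fun_at_gate _ _ Ej) /= IHl // IHr.
exists c'; split=> //.
  move=> x; rewrite out inv ?output_below //.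
    by apply: eq_existsb => z; rewrite /F cf.
  (* Nonconstancy of the closure keeps the output from being an eliminated node. *)
  apply/negP => /forallP H; apply: nc; exists true => y.
  by rewrite -(H y); apply: eq_existsb => z; rewrite /F cf.
move=> j g' /new[k [g [E A ->]]] /= Eop.
move: A; rewrite /act Eop; case: ifPn => // Nl; case: ifPn => // Nr _.
apply: (@eq_independent _ (upclosure (F (lhs g))) _ (upclosure (F (rhs g)))).
- by move=> x; rewrite inv ?(lhs_below E).
- by move=> x; rewrite inv ?(rhs_below E).
- by apply: independent_upclosure; apply: ml E Eop.
Qed.
(** * Multilinear monotone circuits are read-once *)

Section Produced.
Variables (n : nat) (c : monotone_circuit n).

Local Notation F := (fun_at (@variable n) c).

Definition produced_at (u : node 'I_n) : {fset 'X_{1..n}} :=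
  value_at fset0 (fun i : 'I_n => [fset U_(i)%MM]%fset)
    (@fsetU 'X_{1..n}) (@minkowski n) c u.

Lemma produced_at_gate k g : onth (gates c) k = Some g ->
  produced_at (Gate k) =
  (if op g is Vee then @fsetU 'X_{1..n} else @minkowski n)
    (produced_at (lhs g)) (produced_at (rhs g)).
Proof. exact: value_at_gate. Qed.

Lemma minkowskiP (A B : {fset 'X_{1..n}}) m :
  reflect (exists a b, [/\ a \in A, b \in B & m = (a + b)%MM])
          (m \in minkowski A B).
Proof.
apply: (iffP idP) => [/imfset2P[a /= aA [b /= bB ->]]|[a [b [aA bB ->]]]].
  by exists a, b.
by apply/imfset2P; exists a => //; exists b.
Qed.

Lemma fun_at_monotone u : below (size (gates c)) u -> monotone_fun (F u).
Proof.
elim/(@node_ind _ c): u / => [s x y /point_leP xy|k g E IHl IHr x y xy].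
  exact: xy.
rewrite !(fun_at_gate _ _ E); case: (op g) => [/orP[/(IHl _ _ xy)->|/(IHr _ _ xy)->]|].
- by [].
- by rewrite orbT.
- by case/andP=> /(IHl _ _ xy)-> /(IHr _ _ xy)->.
Qed.

(** At an AND gate, minimal points [b], [d] of the operands below [a] have a join satisfying both,
    so the join is [a]. *)
Lemma multilinear_minpoint u : multilinear (@variable n) c ->
  below (size (gates c)) u ->
  forall a, minpoint (F u) a -> expvec a \in produced_at u.
Proof.
move=> ml; elim/(@node_ind _ c): u / => [i a [ai amin]|k g E IHl IHr a].
  pose e : point n := [ffun j => i == j].
  have <- : e = a.
    apply: amin; last by rewrite /fun_at /= /value_at /= /variable ffunE eqxx.
    by apply/point_leP => j; rewrite ffunE => /eqP <-.
  rewrite inE; apply/eqP/mnmP => j.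
  by rewrite !mnmE ffunE.
have FE x := fun_at_gate (@variable n) x E.
rewrite (produced_at_gate E); case Eop: (op g) FE => FE [Fa amin].
  move: Fa; rewrite FE inE => /orP[la|ra]; apply/orP; [left|right].
    by apply: IHl; split=> // b ba lb; apply: amin => //; rewrite FE lb.
  by apply: IHr; split=> // b ba rb; apply: amin => //; rewrite FE rb orbT.
move: Fa; rewrite FE => /andP[la ra].
have [b ba bmin] := minpoint_exists la; have [d da dmin] := minpoint_exists ra.
apply/minkowskiP; exists (expvec b), (expvec d); split; [exact: IHl|exact: IHr|].
pose w : point n := [ffun i => b i || d i].
have <- : w = a.
  apply: amin.
    apply/point_leP => i; rewrite ffunE.
    by case/orP; [move/point_leP: ba|move/point_leP: da]; apply.
  rewrite FE; apply/andP; split.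
    apply: (fun_at_monotone (lhs_below E)) (proj1 bmin).
    by apply/point_leP => i; rewrite ffunE => ->.
  apply: (fun_at_monotone (rhs_below E)) (proj1 dmin).
  by apply/point_leP => i; rewrite ffunE orbC => ->.
(* The sum equals the join unless the supports meet; at a common coordinate both operands would
   depend on the same variable. *)
apply/mnmP => i; rewrite mnmDE !mnmE ffunE.
case bi: (b i); case di: (d i) => //=.
by case: (ml _ _ E Eop i); split; apply: minpoint_depends; eauto.
Qed.

End Produced.

Lemma multilinear_read1 n (g : boolfun n) (c : monotone_circuit n) :
  computes (@variable n) c g -> multilinear (@variable n) c -> read1 g c.
Proof.
move=> cg ml; split=> //; apply/fsubsetP => m /LowP[a [ga amin] ->].
apply: multilinear_minpoint (output_below c) _ _ => //; split; first by rewrite cg.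
by move=> b ba; rewrite cg; apply: amin.
Qed.

(** * The lower envelope of a read-once circuit *)

Section LowerEnvelope.
Variables (n : nat) (c : monotone_circuit n).

Local Notation F := (fun_at (@variable n) c).
Local Notation B := (produced_at c).

(** Evaluation in the (min,+) semiring; [mindegP] identifies it as the least degree of a produced
    vector. *)
Definition mindeg (u : node 'I_n) : nat := value_at 0 (fun _ : 'I_n => 1) minn addn c u.

Lemma mindeg_gate k g : onth (gates c) k = Some g ->
  mindeg (Gate k) =
  (if op g is Vee then minn else addn) (mindeg (lhs g)) (mindeg (rhs g)).
Proof. exact: value_at_gate. Qed.

Lemma mindegP u : below (size (gates c)) u ->
  (forall m, m \in B u -> mindeg u <= mdeg m) /\
  (exists2 m, m \in B u & mdeg m = mindeg u).
Proof.
elim/(@node_ind _ c): u / => [i|k g E [IHl [ml mlB dl]] [IHr [mr mrB dr]]].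
  split=> [m|]; first by rewrite inE => /eqP ->; rewrite mdeg1.
  by exists U_(i)%MM; rewrite ?inE ?mdeg1.
rewrite (mindeg_gate E) (produced_at_gate E); case: (op g); split=> [m|].
- by rewrite inE geq_min => /orP[/IHl ->//|/IHr ->]; rewrite orbT.
- rewrite /minn; case: ifP => _; [exists ml|exists mr] => //.
    by rewrite inE mlB.
  by rewrite inE mrB orbT.
- by case/minkowskiP=> a [b [/IHl la /IHr rb ->]]; rewrite mdegD leq_add.
- exists (ml + mr)%MM; last by rewrite mdegD dl dr.
  by apply/minkowskiP; exists ml, mr.
Qed.

(** The supports of the produced vectors are the terms of a disjunctive normal form of the function
    at [u]. *)
Lemma fun_at_produced u (x : point n) : below (size (gates c)) u ->
  reflect (exists2 b, b \in B u & forall i, 0 < b i -> x i) (F u x).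
Proof.
move=> bu; apply: (iffP idP).
  elim/(@node_ind _ c): u / bu => [i xi|k g E IHl IHr].
    exists U_(i)%MM; first by rewrite inE.
    by move=> j; rewrite mnm1E; case: eqP => // <-.
  rewrite (fun_at_gate _ _ E) (produced_at_gate E); case: (op g).
    case/orP=> [/IHl|/IHr] [b bB bx]; exists b => //; by rewrite inE bB ?orbT.
  case/andP=> [/IHl[a aB ax] /IHr[b bB bx]]; exists (a + b)%MM.
    by apply/minkowskiP; exists a, b.
  by move=> i; rewrite mnmDE addn_gt0 => /orP[/ax|/bx].
elim/(@node_ind _ c): u / bu => [i [b]|k g E IHl IHr [b]].
  by rewrite inE => /eqP -> bx; apply: (bx i); rewrite mnm1E eqxx.
rewrite (fun_at_gate _ _ E) (produced_at_gate E); case: (op g).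
  rewrite inE => /orP[bB|bB] bx; apply/orP; [left; apply: IHl|right; apply: IHr];
  by exists b.
case/minkowskiP=> [a [d [aB dB ->]]] bx; apply/andP.
split; [apply: IHl; exists a|apply: IHr; exists d] => // i Hi; apply: bx;
by rewrite mnmDE addn_gt0 Hi ?orbT.
Qed.

(** Nonnegativity accompanies the support because it rules out cancellation in sums and products. *)
Definition nonneg_supp (A : pred 'X_{1..n}) (p : {mpoly int[n]}) : Prop :=
  forall m, (0 <= p@_m)%R /\ (p@_m != 0)%R = A m.

Definition envelope u := [pred m | (m \in B u) && (mdeg m == mindeg u)].

(** Each coefficient of the product is a sum of nonnegative terms, hence nonzero exactly when some
    term is. *)
Lemma nonneg_suppM (A1 A2 A : pred 'X_{1..n}) p q :
  (forall m, A m <-> exists a b, [/\ A1 a, A2 b & m = (a + b)%MM]) ->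
  nonneg_supp A1 p -> nonneg_supp A2 q -> nonneg_supp A (p * q)%R.
Proof.
move=> HA Hp Hq m; rewrite mcoeffM.
have ge0 (k : 'X_{1..n < (mdeg m).+1, (mdeg m).+1}) :
    (m == (k.1 + k.2)%MM) -> (0 <= p@_k.1 * q@_k.2)%R.
  by move=> _; apply: mulr_ge0; [case: (Hp k.1)|case: (Hq k.2)].
split; first exact: sumr_ge0.
rewrite psumr_neq0 //; apply/hasP/idP => [[k _ /andP[/eqP Em]]|].
  move=> /lt0r_neq0; rewrite mulf_eq0 negb_or => /andP[Np Nq].
  apply/HA; exists k.1, k.2.
  by case: (Hp k.1) => _ <-; case: (Hq k.2) => _ <-.
case/HA=> a [b [Aa Ab Em]].
(* The convolution ranges over monomials of degree below [(mdeg m).+1], which covers every summand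
   of [m]. *)
have la : mdeg a < (mdeg m).+1 by rewrite Em mdegD ltnS leq_addr.
have lb : mdeg b < (mdeg m).+1 by rewrite Em mdegD ltnS leq_addl.
exists (BMultinom la, BMultinom lb); first exact: mem_index_enum.
rewrite /= Em eqxx /= lt0r mulf_eq0 negb_or.
case: (Hp a) (Hq b) => pa -> [qb ->].
by rewrite Aa Ab mulr_ge0.
Qed.

Lemma nonneg_suppD (A1 A2 : pred 'X_{1..n}) p q :
  nonneg_supp A1 p -> nonneg_supp A2 q -> nonneg_supp (predU A1 A2) (p + q)%R.
Proof.
move=> Hp Hq m; rewrite mcoeffD; case: (Hp m) (Hq m) => p0 /= <- [q0 <-].
by rewrite addr_ge0 // paddr_eq0 // negb_and.
Qed.

Lemma nonneg_supp_eq (A1 A2 : pred 'X_{1..n}) p :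
  A1 =1 A2 -> nonneg_supp A1 p -> nonneg_supp A2 p.
Proof. by move=> E H m; rewrite -E. Qed.

(* A sum gate keeps only the operand of smaller minimum degree, both operands
   in case of a tie; the envelope of a Minkowski sum is the sum of the
   envelopes, so product gates are kept. *)
Lemma envelope_circuit : exists (c' : arith_circuit n),
  circuit_size c' <= circuit_size c /\
  nonneg_supp (envelope (output c)) (poly_of c').
Proof.
pose act (g : gate 'I_n) := if op g is Vee then
  if mindeg (lhs g) < mindeg (rhs g) then Some true
  else if mindeg (rhs g) < mindeg (lhs g) then Some false else None
  else None.
have [c' [phi [sz out phi_in keep _]]] := prune id act c.
exists c'; split=> //; rewrite /poly_of out.
pose val u : {mpoly int[n]} :=
  value_at 0%R (fun i : 'I_n => 'X_i : {mpoly int[n]})%R +%R *%R c' u.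
suff H u : below (size (gates c)) u -> nonneg_supp (envelope u) (val (phi u)).
  exact: H (output_below c).
elim/(@node_ind _ c): u / => [i m|k g E IHl IHr].
  rewrite phi_in /val /value_at /= mcoeffX inE eq_sym.
  by case: eqP => // ->; rewrite /mindeg /value_at /= mdeg1.
have [dl _] := mindegP (lhs_below E); have [dr _] := mindegP (rhs_below E).
have EE m : envelope (Gate k) m = (m \in B (Gate k)) && (mdeg m == mindeg (Gate k)).
  by [].
have BE := produced_at_gate E; have ME := mindeg_gate E.
have := keep _ _ E; rewrite /act.
case Eop: (op g) BE ME => BE ME; last first.
  case=> j -> Ej; rewrite /val (value_at_gate _ _ _ _ Ej) /=.
  apply: nonneg_suppM IHl IHr => m; rewrite EE BE ME; split.
    case/andP=> /minkowskiP[a [b [aB bB ->]]].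
    rewrite mdegD => /eqP D; exists a, b; rewrite !inE aB bB /=.
    (* Each degree is at least its own minimum and the sums agree, so both minima are attained. *)
    have la := dl _ aB; have lb := dr _ bB.
    have : mdeg a = mindeg (lhs g).
      apply/eqP; rewrite eqn_leq la andbT -(leq_add2r (mdeg b)) D leq_add2l //.
    by move=> ea; move/eqP: D; rewrite ea eqn_add2l => ->; rewrite eqxx.
  case=> a [b [/andP[aB /eqP ea] /andP[bB /eqP eb] ->]].
  by rewrite mdegD ea eb eqxx andbT; apply/minkowskiP; exists a, b.
case: ltngtP => D.
(* Every vector of the right operand exceeds the minimum degree of the gate, so dropping that
   operand loses nothing. *)
- move=> ->; apply: nonneg_supp_eq IHl => m.
  rewrite EE BE ME in_fsetU [LHS]/= (minn_idPl (ltnW D)).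
  case: eqP => [em|]; rewrite ?andbF // !andbT.
  case: (boolP (m \in B (rhs g))) => [/dr|]; last by rewrite orbF.
  by rewrite em leqNgt D.
- move=> ->; apply: nonneg_supp_eq IHr => m.
  rewrite EE BE ME in_fsetU [LHS]/= (minn_idPr (ltnW D)).
  case: eqP => [em|]; rewrite ?andbF // !andbT.
  case: (boolP (m \in B (lhs g))) => [/dl|]; last by [].
  by rewrite em leqNgt D.
case=> j -> Ej; rewrite /val (value_at_gate _ _ _ _ Ej) /=.
apply: nonneg_supp_eq (nonneg_suppD IHl IHr) => m.
by rewrite EE BE ME in_fsetU [LHS]/= D minnn andb_orl.
Qed.

End LowerEnvelope.

(** The coefficients of the polynomial itself serve: a nonnegative nonzero integer is at least 1. *)
Lemma nonneg_supp_produces n (A : {fset 'X_{1..n}}) (c : arith_circuit n) :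
  nonneg_supp (mem A) (poly_of c) -> produces_support A c.
Proof.
move=> H; exists (fun a => (poly_of c)@_a)%R; split=> [a aA|].
  by have [ge0 E] := H a; rewrite -gtz0_ge1 lt0r E ge0 andbT.
apply/mpolyP => m; rewrite raddf_sum /=.
case: (boolP (m \in A)) => mA.
  rewrite (bigD1_seq m) ?fset_uniq //= mcoeffZ mcoeffX eqxx mulr1.
  rewrite big1 ?addr0 // => a /negPf am.
  by rewrite mcoeffZ mcoeffX am mulr0.
rewrite big_seq big1 => [|a aA].
  by have [_ E] := H m; apply/eqP/negPn; rewrite E.
rewrite mcoeffZ mcoeffX; case: eqP => [am|]; last by rewrite mulr0.
by rewrite -am aA in mA.
Qed.

Lemma envelope_Low n (g : boolfun n) (c : monotone_circuit n) : read1 g c ->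
  envelope c (output c) =1 mem (Env (Low g)).
Proof.
case=> cg /fsubsetP sub m.
have [dmin [m0 m0B m0d]] := mindegP (output_below c).
(* The support of [b] is a true point of [g]; a minimal point below it has 0/1 entries and so lies
   below [b] itself. *)
have above b : b \in produced c ->
    exists2 z, minpoint g z & (expvec z <= b)%MM.
  move=> bB; pose x : point n := [ffun i => 0 < b i].
  have gx : g x.
    rewrite -cg; apply/(fun_at_produced _ (output_below c)).
    by exists b => // i; rewrite ffunE.
  have [z /point_leP zx zmin] := minpoint_exists gx; exists z => //.
  apply/mnm_lepP => i; rewrite mnmE; case zi: (z i) => //.
  by move: (zx i zi); rewrite ffunE.
have EnvP : reflect (m \in Low g /\ forall b, b \in Low g -> mdeg m <= mdeg b)
    (m \in Env (Low g)).
  apply: (iffP idP); rewrite !inE /=.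
    case/andP=> mL /forallP H; split=> // b bL; exact: (H [` bL]%fset).
  by case=> mL H; rewrite mL; apply/forallP => b; apply/H/valP.
apply/idP/idP => [/andP[mB /eqP md]|/EnvP[mL mmin]].
  have [z zmin zm] := above m mB.
  have zL : expvec z \in Low g by apply/LowP; exists z.
  (* Being read-1 makes [expvec z] a produced vector, so its degree is not less than that of [m]. *)
  have Ez : expvec z = m.
    by apply: mnm_le_deg_eq => //; rewrite md; apply/dmin/sub.
  apply/EnvP; rewrite -{1}Ez; split=> // b bL.
  by rewrite md; apply/dmin/sub.
apply/andP; split; first exact: sub.
(* The lowest vector below [m0] bounds the degree of [m] by the minimum produced degree. *)
have [z zmin zm0] := above m0 m0B.
rewrite eqn_leq (dmin _ (sub _ mL)) andbT -m0d.
apply: leq_trans (mnm_le_mdeg zm0); apply: mmin.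
by apply/LowP; exists z.
Qed.

Lemma read1_arith n (g : boolfun n) (c : monotone_circuit n) : read1 g c ->
  exists c' : arith_circuit n,
    produces_support (Env (Low g)) c' /\ circuit_size c' <= circuit_size c.
Proof.
move=> r1; have [c' [sz H]] := envelope_circuit c; exists c'; split=> //.
exact: nonneg_supp_produces (nonneg_supp_eq (envelope_Low r1) H).
Qed.

(** * Existence of circuits *)

Section Existence.
Variables (n : nat).

Local Notation lit := (@literal_fun n).

(* Extending an arbitrary circuit, rather than juxtaposing two circuits, avoids
   any renumbering of gates. *)
Definition extensible (g : boolfun n) : Prop :=
  forall c : demorgan_circuit n, multilinear lit c ->
  exists c' : demorgan_circuit n,
    [/\ multilinear lit c', computes lit c' g
      & exists e, gates c' = gates c ++ e].

Lemma eq_extensible g h : g =1 h -> extensible g -> extensible h.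
Proof.
move=> E H c /H[c' [ml cg pre]]; exists c'; split=> // x; by rewrite cg E.
Qed.

Lemma fun_at_cat (c c' : demorgan_circuit n) e u :
  gates c' = gates c ++ e -> below (size (gates c)) u ->
  fun_at lit c' u =1 fun_at lit c u.
Proof.
by move=> E bu x; rewrite /fun_at /value_at E node_value_cat.
Qed.

Lemma extensible_lit l : extensible (literal_fun l).
Proof.
move=> c ml; exists (@Circuit _ (gates c) (Input l) (@gates_below _ c) isT).
by split=> //; exists [::]; rewrite cats0.
Qed.

(** The circuit is extended to compute [g], then [h], then by one gate on the two outputs; appended
    gates do not alter earlier functions, so multilinearity persists. *)
Lemma extensible_gate o g h : extensible g -> extensible h ->
  (o = Wedge -> independent g h) ->
  extensible (fun x => (if o is Vee then orb else andb) (g x) (h x)).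
Proof.
move=> Hg Hh I c /Hg[c1 [/Hh[c2 [ml2 ch [e2 E2]]] cg [e1 E1]]].
pose G := MkGate o (output c1) (output c2).
have b1 : below (size (gates c2)) (output c1).
  by apply: below_leq (output_below c1); rewrite E2 size_cat leq_addr.
have cg2 : fun_at lit c2 (output c1) =1 g.
  by move=> x; rewrite (fun_at_cat E2 (output_below c1)) cg.
have wf k q : onth (rcons (gates c2) G) k = Some q ->
    below k (lhs q) && below k (rhs q).
  move=> Ek; have [[_ /gates_below//]|[-> ->]] := onth_rconsP Ek.
  by rewrite /= b1 output_below.
have ob : below (size (rcons (gates c2) G)) (Gate (size (gates c2)) : node (literal n)).
  by rewrite /= size_rcons.
pose c3 := Circuit wf ob.
have E3 : gates c3 = gates c2 ++ [:: G] by rewrite cats1.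
exists c3; split.
- move=> k q Ek Eop; have [[_ Ek']|[_ Eq]] := onth_rconsP Ek.
    apply: eq_independent (ml2 _ _ Ek' Eop) => x; apply/esym;
    by apply: (fun_at_cat E3); first [exact: lhs_below Ek'|exact: rhs_below Ek'].
  rewrite Eq /= in Eop *; apply: eq_independent (I Eop) => x;
  by rewrite (fun_at_cat E3) ?output_below ?cg2 ?ch.
- move=> x; rewrite (@fun_at_gate _ _ _ c3 _ G) /=; last first.
    by rewrite onth_rcons ltnn eqxx.
  by rewrite !(fun_at_cat E3) ?output_below // cg2 ch.
- by exists (e1 ++ rcons e2 G); rewrite E3 E2 E1 -!catA cats1.
Qed.

(** The variables are distinct, so the first literal is independent of the conjunction of the rest.
    The list is nonempty because there are no constant inputs. *)
Lemma extensible_term (a : point n) (i : 'I_n) s : uniq (i :: s) ->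
  extensible (fun x => all (fun j => x j == a j) (i :: s)).
Proof.
have one j : extensible (fun x : point n => x j == a j).
  apply: (@eq_extensible (literal_fun (if a j then Pos j else Neg j))).
    by move=> x; rewrite /literal_fun; case: (a j); case: (x j).
  exact: extensible_lit.
elim: s i => [|j s IH] i.
  by move=> _; apply: eq_extensible (one i) => x; rewrite /= andbT.
rewrite cons_uniq => /andP[ni u].
apply: (@extensible_gate Wedge _ _ (one i) (IH j u)) => _ k [].
case=> x [y [E N]] [x' [y' [E' N']]].
have ki : k = i.
  by apply/eqP/negPn/negP; rewrite eq_sym => nki; apply: N; rewrite E.
apply: N'; apply: eq_in_all => l ls; rewrite E' // ki.
by apply: contraNneq ni => <-.
Qed.

(** The full disjunctive normal form is multilinear, OR gates being unrestricted; [i] and [a] make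
    its terms and the disjunction nonempty. *)
Lemma extensible_nonzero (f : boolfun n) (i : 'I_n) a : f a -> extensible f.
Proof.
move=> fa.
have term b : extensible (fun x => x == b).
  have [s Es] : exists s, perm_eq (i :: s) (enum 'I_n).
    by exists (rem i (enum 'I_n)); rewrite perm_sym perm_to_rem ?mem_enum.
  have u : uniq (i :: s) by rewrite (perm_uniq Es) enum_uniq.
  apply: eq_extensible (@extensible_term b i s u) => x.
  rewrite (perm_all _ Es); apply/allP/eqP => [H|-> //].
  by apply/ffunP => j; apply/eqP/H; rewrite mem_enum.
have many b s : extensible (fun x => has (pred1 x) (b :: s)).
  elim: s b => [|d s IH] b.
    by apply: eq_extensible (term b) => x; rewrite /= orbF eq_sym.
  apply: eq_extensible (@extensible_gate Vee _ _ (term b) (IH d) _) => // x.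
  by rewrite /= eq_sym.
have [s Es] : exists s, perm_eq (a :: s) (enum [pred x | f x]).
  by exists (rem a (enum [pred x | f x])); rewrite perm_sym perm_to_rem ?mem_enum.
apply: eq_extensible (many a s) => x.
by rewrite has_pred1 (perm_mem Es) mem_enum.
Qed.

Lemma multilinear_exists (f : boolfun n) : nonconstant (upclosure f) ->
  exists c : demorgan_circuit n, computes lit c f /\ multilinear lit c.
Proof.
move=> nc.
have [a fa] : exists a, f a.
  case: (pickP f) => [a fa|f0]; first by exists a.
  by case: nc; exists false => x; apply/upclosureP => -[z _]; rewrite f0.
(* Without variables there is a single point, and every function is constant. *)
case: (pickP 'I_n) => [i _|noi]; last first.
  case: nc; exists (upclosure f a) => x.
  by congr (upclosure f _); apply/ffunP => i; have := noi i.
have wf0 k (g : gate (literal n)) :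
    onth [::] k = Some g -> below k (lhs g) && below k (rhs g) by rewrite onth0n.
have [|c [ml cf _]] :=
    extensible_nonzero i fa (c := @Circuit _ _ (Input (Pos i)) wf0 isT).
  by move=> k g; rewrite onth0n.
by exists c.
Qed.

End Existence.

(** * Minimum sizes and the chain of inequalities *)

Lemma minimum_size_exists X (P : circuit X -> Prop) :
  (exists c, P c) -> exists m, minimum_size P m.
Proof.
case=> c0 P0; apply: NNPP => N.
(* If no minimum were attained, every lower bound could be raised by one, beyond the size of
   [c0]. *)
have H m : forall c, P c -> m <= circuit_size c.
  elim: m => [//|m IH] c Pc; rewrite ltn_neqAle IH // andbT.
  by apply/eqP => E; apply: N; exists m; split=> //; exists c.
by have := H (circuit_size c0).+1 c0 P0; rewrite ltnn.
Qed.

Lemma minimum_size_leq X Y (P : circuit X -> Prop) (Q : circuit Y -> Prop) p q :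
  (forall c, P c -> exists c', Q c' /\ circuit_size c' <= circuit_size c) ->
  minimum_size P p -> minimum_size Q q -> q <= p.
Proof.
move=> H [[c [Pc <-]] _] [_ Qmin].
by have [c' [Qc' le]] := H c Pc; apply: leq_trans (Qmin _ Qc') le.
Qed.

Theorem theorem3 (n : nat) (f : boolfun n) (hf : nonconstant (upclosure f)) :
  exists a r m l : nat,
    [/\ Arith_is (Env (Low f)) a, Read1_is (upclosure f) r,
        mLin_is (upclosure f) m & Lin_is f l]
    /\ [/\ a <= r, r <= m & m <= l].
Proof.
pose PL (c : demorgan_circuit n) :=
  computes (@literal_fun n) c f /\ multilinear (@literal_fun n) c.
pose PM (c : monotone_circuit n) :=
  computes (@variable n) c (upclosure f) /\ multilinear (@variable n) c.
have LM c : PL c -> exists c', PM c' /\ circuit_size c' <= circuit_size c.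
  by case=> cf ml; have [c' [? ? ?]] := multilinear_upclosure hf cf ml; exists c'.
have MR c : PM c ->
    exists c', read1 (upclosure f) c' /\ circuit_size c' <= circuit_size c.
  by case=> cf ml; exists c; split=> //; apply: multilinear_read1.
have RA c : read1 (upclosure f) c ->
    exists c', produces_support (Env (Low f)) c' /\ circuit_size c' <= circuit_size c.
  by move=> /read1_arith; rewrite Low_upclosure.
(* One multilinear DeMorgan circuit, carried down the three conversions, shows that all four minima
   exist. *)
have [cL hL] : exists c, PL c := multilinear_exists hf.
have [cM [hM _]] := LM _ hL; have [cR [hR _]] := MR _ hM.
have [cA [hA _]] := RA _ hR.
have [l Hl] := minimum_size_exists (ex_intro _ _ hL).
have [m Hm] := minimum_size_exists (ex_intro _ _ hM).
have [r Hr] := minimum_size_exists (ex_intro _ _ hR).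
have [a Ha] := minimum_size_exists (ex_intro _ _ hA).
exists a, r, m, l; split; split=> //.
- exact: minimum_size_leq RA Hr Ha.
- exact: minimum_size_leq MR Hm Hr.
- exact: minimum_size_leq LM Hl Hm.
Qed.
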